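(* Let $k\ge 1$ be a fixed integer. Then $$\hat{\xi}_{k-1}(\Delta)=1-\frac{1}{k+1}\sum_{j=1}^{k+1}\frac{1}{j}.$$
   Context: Let $\overline{\Delta}=\{(x,y)\in[0,\infty)^2:x\le y\}$ and $\Delta=\{(x,y)\in[0,\infty)^2:x<y\}$. For $q\in(0,1]$, $c\in[0,\infty)$, $t\in[0,1]$ let $$\Lambda_{q,c}(t)=\exp(-c(1-qt)^k)-\frac{c}{q(k+1)}\left(1-(1-qt)^{k+1}-q(k+1)t(1-qt)^k\right),\qquad \lambda_{q,c}=\max_{t\in[0,1]}\Lambda_{q,c}(t),$$ and for $r,s\in[0,\infty)$ let $\hat{\beta}_{k-1}^{r,s}=\lambda_{1,s}-\exp(-r)\lambda_{\exp(-r),s-r}$ if $r<s$, and $\hat{\beta}_{k-1}^{r,s}=\lambda_{1,s}-\exp(-r)$ if $r\ge s$. $\hat{\xi}_{\mathrm{Ver},k-1}$ is the unique probability measure on $\overline{\Delta}$ such that for all $r,s\in[0,\infty)$, $\hat{\xi}_{\mathrm{Ver},k-1}(([0,r]\times[0,s])\cap\overline{\Delta})=1-\exp(-r)-\hat{\beta}_{k-1}^{r,s}$, and $\hat{\xi}_{k-1}$ is its restriction to $\Delta$. *)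

(* Defs.v *)
From mathcomp Require Import all_boot all_order all_algebra.
From mathcomp Require Import all_classical all_reals all_analysis.

Set Implicit Arguments.
Unset Strict Implicit.
Unset Printing Implicit Defensive.

Import Order.TTheory GRing.Theory Num.Theory.
Import numFieldNormedType.Exports.

Local Open Scope classical_set_scope.
Local Open Scope ring_scope.

Definition Lambda (R : realType) (k : nat) (q c t : R) : R :=
  expR (- (c * (1 - q * t) ^+ k))
  - c / (q * k.+1%:R)
    * (1 - (1 - q * t) ^+ k.+1 - q * k.+1%:R * t * (1 - q * t) ^+ k).

(* The supremum is a maximum, see [lambda_is_max]. *)
Definition lambda (R : realType) (k : nat) (q c : R) : R :=
  sup [set Lambda k q c t | t in `[0, 1]].

Lemma continuous_Lambda (R : realType) (k : nat) (q c : R) :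
  continuous (Lambda k q c).
Proof.
have cl : continuous (fun t : R => 1 - q * t).
  move=> t; apply: cvgB; first exact: cvg_cst.
  by apply: cvgM; [exact: cvg_cst | exact: cvg_id].
have cX n : continuous (fun t : R => (1 - q * t) ^+ n).
  by move=> t; apply: (@continuous_comp _ _ _ (fun t : R => 1 - q * t)
       (fun y : R => y ^+ n)); [exact: cl | exact: exprn_continuous].
move=> t; apply: cvgB.
  apply: (@continuous_comp _ _ _ (fun t : R => - (c * (1 - q * t) ^+ k)) expR).
    by apply: cvgN; apply: cvgM; [exact: cvg_cst | exact: cX].
  exact: continuous_expR.
apply: cvgM; first exact: cvg_cst.
apply: cvgB; first by apply: cvgB; [exact: cvg_cst | exact: cX].
by apply: cvgM; [apply: cvgM; [exact: cvg_cst | exact: cvg_id] | exact: cX].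
Qed.

Lemma lambda_is_max (R : realType) (k : nat) (q c : R) :
  (exists2 t, t \in `[0, 1] & lambda k q c = Lambda k q c t) /\
  (forall t, t \in `[0, 1] -> Lambda k q c t <= lambda k q c).
Proof.
have [t0 t0I maxt0] := @EVT_max R (Lambda k q c) 0 1 ler01
  (continuous_subspaceT (@continuous_Lambda R k q c)).
suff lE : lambda k q c = Lambda k q c t0.
  by split; [exists t0 | move=> t /maxt0; rewrite lE].
apply/eqP; rewrite eq_le; apply/andP; split.
  apply: ge_sup; first by exists (Lambda k q c t0); exists t0.
  by move=> _ [t tI <-]; exact: maxt0.
apply: ub_le_sup; last by exists t0.
by exists (Lambda k q c t0) => _ [t tI <-]; exact: maxt0.
Qed.

(* [beta_hat k r s] is \hat\beta_{k-1}^{r,s}; all objects below are likewise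
   indexed by [k] where the mathematical notation carries the index k-1. *)
Definition beta_hat (R : realType) (k : nat) (r s : R) : R :=
  if r < s then lambda k 1 s - expR (- r) * lambda k (expR (- r)) (s - r)
  else lambda k 1 s - expR (- r).

Definition Delta_bar (R : realType) : set (R * R) :=
  [set z | [/\ 0 <= z.1, 0 <= z.2 & z.1 <= z.2]].

Definition Delta (R : realType) : set (R * R) :=
  [set z | [/\ 0 <= z.1, 0 <= z.2 & z.1 < z.2]].

Lemma measurable_Delta (R : realType) : measurable (@Delta R).
Proof.
have -> : @Delta R = [set z | 0 <= z.1] `&` [set z | 0 <= z.2]
                     `&` [set z | z.1 < z.2].
  by apply/seteqP; split=> z /=; [case | case=> [[]]].
have mb (f : R * R -> bool) : measurable_fun setT f -> measurable [set z | f z].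
  by move=> /(_ measurableT [set true] I); rewrite setTI.
apply: measurableI; first apply: measurableI; apply: mb.
- apply: measurable_realfun.measurable_fun_ler; first exact: measurable_cst.
  exact: measurable_fst.
- apply: measurable_realfun.measurable_fun_ler; first exact: measurable_cst.
  exact: measurable_snd.
- apply: measurable_realfun.measurable_fun_ltr; first exact: measurable_fst.
  exact: measurable_snd.
Qed.

(* The defining property of \hat\xi_{Ver,k-1}. A probability measure on
   Delta_bar is encoded as a probability measure on the Borel sets of the plane
   that is carried by Delta_bar. *)
Definition is_xi_Ver (R : realType) (k : nat) (xi : probability (R * R)%type R)
    : Prop :=
  xi (@Delta_bar R) = 1%E /\
  forall r s : R, 0 <= r -> 0 <= s ->
    xi ((`[0, r] `*` `[0, s]) `&` @Delta_bar R)
    = (1 - expR (- r) - beta_hat k r s)%:E.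

Definition xi_hat (R : realType) (xi : probability (R * R)%type R)
    : set (R * R) -> \bar R :=
  mrestr xi (@measurable_Delta R).

(* Main.v *)
Require Import Defs.
From mathcomp Require Import all_boot all_order all_algebra.
From mathcomp Require Import all_classical all_reals all_analysis.
From mathcomp Require Import ring lra.

(* For 0 <= a < b the points of Delta_bar with both coordinates in (a, b] have
   mass F(b, b) - F(a, b) = q (1 - lambda_{q, h}), where F is the distribution
   function, q = exp(-a) and h = b - a.  To first order in h the maximum
   lambda_{q, h} is attained at t = 1, so this mass lies between
   h g(a) / (1 + h) and h g(a), where g(a) = (1 - (1 - q)^(k+1)) / (k+1).
   Squares of side h along the diagonal cover the diagonal and are contained in
   the strip y - x <= h, so letting h tend to 0 the diagonal has mass
   int_0^oo g = (1 / (k+1)) sum_(j <= k+1) 1/j, by the antiderivative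
   (1 / (k+1)) sum_(j <= k+1) (1 - exp(-a))^j / j of g. *)

Import Order.TTheory GRing.Theory Num.Theory.
Import numFieldNormedType.Exports.
Local Open Scope ring_scope.

(** * Elementary inequalities for powers and the exponential *)

(** The graph of a convex power lies above its tangent at [u]. In the induction, multiplying by [v]
    leaves the surplus (n+1) u^n (v-u)^2. *)
Lemma exprS_tangent_le {R : realDomainType} (n : nat) (u v : R) :
  0 <= u -> 0 <= v ->
  u ^+ n.+1 + n.+1%:R * u ^+ n * (v - u) <= v ^+ n.+1.
Proof.
move=> u0 v0; elim: n => [|n IH]; first by rewrite !expr1 expr0; lra.
have /(ler_wpM2l v0) := IH; rewrite -exprS; apply: le_trans.
have : 0 <= n.+1%:R * u ^+ n * (v - u) ^+ 2.
  by rewrite mulr_ge0 ?sqr_ge0// mulr_ge0// exprn_ge0.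
rewrite -[n.+2%:R]natr1 !exprS; nra.
Qed.

Lemma expRN_le_inv {R : realType} (x : R) : 0 <= x -> expR (- x) <= (1 + x)^-1.
Proof.
move=> x0; rewrite expRN lef_pV2 ?posrE ?expR_gt0// ?expR_ge1Dx//; lra.
Qed.

(** * The density along the diagonal and its antiderivative *)

Definition diag_density {R : realType} (k : nat) (a : R) : R :=
  (1 - (1 - expR (- a)) ^+ k.+1) / k.+1%:R.

Definition diag_cdf {R : realType} (k : nat) (a : R) : R :=
  (k.+1%:R)^-1 * \sum_(1 <= j < k.+2) (j%:R)^-1 * (1 - expR (- a)) ^+ j.

Lemma onemexpRN_itv {R : realType} (a : R) : 0 <= a -> 0 <= 1 - expR (- a) <= 1.
Proof.
move=> a0; have := expR_gt0 (- a).
have : expR (- a) <= 1 by rewrite -expR0 ler_expR oppr_le0.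
by move=> ? ?; apply/andP; split; lra.
Qed.

Lemma diag_density_ge0 {R : realType} (k : nat) (a : R) :
  0 <= a -> 0 <= diag_density k a.
Proof.
move=> /onemexpRN_itv /andP[p0 p1].
by rewrite divr_ge0// subr_ge0 exprn_ile1.
Qed.

Lemma diag_density_le1 {R : realType} (k : nat) (a : R) :
  0 <= a -> diag_density k a <= 1.
Proof.
move=> /onemexpRN_itv /andP[p0 p1].
rewrite ler_pdivrMr// mul1r (@le_trans _ _ 1)// ?ler1n//.
by rewrite lerBlDr lerDl exprn_ge0.
Qed.

Lemma diag_density_nonincreasing {R : realType} (k : nat) (a b : R) :
  0 <= a -> a <= b -> diag_density k b <= diag_density k a.
Proof.
move=> a0 ab; have /andP[p0 _] := onemexpRN_itv a a0.
have /andP[r0 _] := onemexpRN_itv b (le_trans a0 ab).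
rewrite ler_pM2r ?invr_gt0// lerB// lerXn2r ?nnegrE// lerB//.
by rewrite ler_expR lerN2.
Qed.

(** With p = 1 - exp(-a), each p^j / j has derivative (1 - p) p^(j-1), and the geometric sum of
    these is 1 - p^(k+1). *)
Lemma is_derive_diag_cdf {R : realType} (k : nat) (a : R) :
  is_derive a 1 (diag_cdf k) (diag_density k a).
Proof.
pose p : R -> R := fun y => 1 - expR (- y).
have dp : is_derive a 1 p (expR (- a)).
  by apply: is_derive_eq; rewrite /GRing.scale /=; ring.
have -> : diag_cdf k =
    (k.+1%:R)^-1 \*: (\sum_(j < k.+1) (j.+1%:R)^-1 \*: (p ^+ j.+1) : R -> R).
  apply/funext => y; rewrite /diag_cdf big_add1 big_mkord.
  rewrite /= fct_sumE; congr (_ * _); apply: eq_bigr => j _.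
  by rewrite -[RHS]/(_ * (p ^+ _) y) exprfctE.
have dpj (j : 'I_k.+1) := is_deriveZ (j.+1%:R)^-1 (is_deriveX j.+1 dp).
apply: (is_derive_eq (is_deriveZ (k.+1%:R)^-1 (is_derive_sum dpj))).
rewrite /diag_density /GRing.scale /= mulrC; congr (_ / _).
have -> : 1 - (1 - expR (- a)) ^+ k.+1 =
    \sum_(j < k.+1) expR (- a) * (1 - expR (- a)) ^+ j.
  by rewrite -mulr_sumr -opprB subrX1 -mulNr opprB subKr.
apply: eq_bigr => j _.
by rewrite /GRing.scale /= -mulrA mulKf ?pnatr_eq0// mulrC.
Qed.

Lemma diag_cdf_mvt {R : realType} (k : nat) (a b : R) : 0 <= a -> a < b ->
  (b - a) * diag_density k b <= diag_cdf k b - diag_cdf k a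
    <= (b - a) * diag_density k a.
Proof.
move=> a0 ab.
have [|c] := MVT ab (fun x _ => is_derive_diag_cdf k x).
  apply: continuous_subspaceT => x; apply: differentiable_continuous.
  by apply/derivable1_diffP; have [] := is_derive_diag_cdf k x.
rewrite in_itv/= => /andP[ac cb] ->; rewrite [_ * (b - a)]mulrC.
rewrite !ler_pM2l ?subr_gt0// !diag_density_nonincreasing// ?ltW//.
exact: le_lt_trans ac.
Qed.

Lemma diag_cdf0 {R : realType} (k : nat) : diag_cdf k 0 = 0 :> R.
Proof.
rewrite /diag_cdf oppr0 expR0 subrr big_nat big1 ?mulr0// => j /andP[j1 _].
by rewrite expr0n gtn_eqF// mulr0.
Qed.

Lemma diag_cdf_le {R : realType} (k : nat) (a : R) : 0 <= a ->
  diag_cdf k a <= (k.+1%:R)^-1 * \sum_(1 <= j < k.+2) (j%:R)^-1.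
Proof.
move=> /onemexpRN_itv /andP[p0 p1].
rewrite ler_wpM2l ?invr_ge0// ler_sum// => j _.
by rewrite ler_piMr ?invr_ge0// exprn_ile1.
Qed.

(** Bernoulli's inequality 1 - p^j <= j (1 - p) with p = 1 - exp(-a) bounds the defect of each of
    the k+1 terms by exp(-a), hence also their average. The rational bound makes the later
    comparison with [harmonic] immediate. *)
Lemma diag_cdf_ge {R : realType} (k : nat) (a : R) : 0 <= a ->
  (k.+1%:R)^-1 * (\sum_(1 <= j < k.+2) (j%:R)^-1) - (1 + a)^-1 <= diag_cdf k a.
Proof.
move=> a0; have /andP[p0 p1] := onemexpRN_itv a a0.
set S := (X in X - _); apply: (@le_trans _ _ (S - expR (- a))).
  by rewrite lerB// expRN_le_inv.
rewrite lerBlDr /S /diag_cdf -lerBlDl -mulrBr -sumrB.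
rewrite mulrC ler_pdivrMr// mulr_natr.
have -> : expR (- a) *+ k.+1 = \sum_(1 <= j < k.+2) expR (- a).
  by rewrite sumr_const_nat subn1.
rewrite big_nat [leRHS]big_nat ler_sum// => -[//|j] _.
rewrite -[X in X - _]mulr1 -mulrBr ler_pdivrMl//.
have := @exprS_tangent_le _ j 1 (1 - expR (- a)) ler01 p0.
rewrite !expr1n; lra.
Qed.

(** * First-order estimates for the maximum in the parameter h *)

(** This is the coefficient of h in q (1 - Lambda), expanded at h = 0. *)
Definition Lambda_loss {R : realType} (k : nat) (q t : R) : R :=
  q * (1 - t) * (1 - q * t) ^+ k + (1 - (1 - q * t) ^+ k.+1) / k.+1%:R.

(** The bracket isolates the remainder exp(-y) - 1 + y with y = h (1 - q t)^k, which is nonnegative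
    and of second order in h. *)
Lemma Lambda_linearized {R : realType} (k : nat) (q h t : R) : 0 < q ->
  q * Lambda k q h t =
  q * (expR (- (h * (1 - q * t) ^+ k)) - 1 + h * (1 - q * t) ^+ k)
  + q - h * Lambda_loss k q t.
Proof.
move=> q0; rewrite /Lambda /Lambda_loss; field.
by rewrite addrC natr1 pnatr_eq0 (gt_eqF q0).
Qed.

(* Compare with the value at t = 1, the maximiser to first order in h. *)
Lemma onem_lambda_le {R : realType} (k : nat) (q h : R) : 0 < q ->
  q * (1 - lambda k q h) <= h * ((1 - (1 - q) ^+ k.+1) / k.+1%:R).
Proof.
move=> q0.
have I1 : (1 : R) \in `[0, 1] by rewrite in_itv/= ler01 lexx.
have [_ /(_ 1 I1)] := lambda_is_max k q h.
move=> /(ler_wpM2l (ltW q0)); rewrite Lambda_linearized// /Lambda_loss.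
rewrite subrr mulr0 mul0r add0r mulr1.
have := expR_ge1Dx (- (h * (1 - q) ^+ k)).
set e := expR _; set d := _ / _; set x := _ ^+ k => e1 e2.
have : 0 <= q * (e - 1 + h * x) by apply: mulr_ge0; [exact: ltW | lra].
lra.
Qed.

(** Write x = (1 - q t)^k. The loss is at least its value D at t = 1, and also at least q x. The
    second bound lets the factor 1 + h absorb the remainder, which costs at most h^2 q x. *)
Lemma onem_Lambda_ge {R : realType} (k : nat) (q h t : R) :
  0 < q -> q <= 1 -> 0 <= h -> 0 <= t -> t <= 1 ->
  h * ((1 - (1 - q) ^+ k.+1) / k.+1%:R) <= (1 + h) * (q * (1 - Lambda k q h t)).
Proof.
move=> q0 q1 h0 t0 t1.
rewrite mulrBr mulr1 Lambda_linearized//.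
have u0 : 0 <= 1 - q * t by rewrite subr_ge0 mulr_ile1// ltW.
have u1 : 1 - q * t <= 1 by rewrite lerBlDr lerDl mulr_ge0// ltW.
have v0 : 0 <= 1 - q by lra.
have := exprS_tangent_le k _ _ u0 ler01; rewrite expr1n.
have := exprS_tangent_le k _ _ u0 v0.
have x0 : 0 <= (1 - q * t) ^+ k by rewrite exprn_ge0.
rewrite /Lambda_loss.
move: x0; set x := (1 - q * t) ^+ k; set y := (1 - q) ^+ k.+1.
set z := (1 - q * t) ^+ k.+1; set G := (1 - z) / _; set D := (1 - y) / _.
move=> x0 T2 T1.
have k0 : 0 < k.+1%:R :> R by [].
(* Tangent at 1 - q t evaluated at 1 - q for [DG], and at 1 for [xG]; adding q (1 - t) x to [xG]
   gives loss >= q x. *)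
have DG : D <= q * (1 - t) * x + G.
  by rewrite /D /G ler_pdivrMr// mulrDl divfK ?pnatr_eq0//; lra.
have xG : q * t * x <= G by rewrite ler_pdivlMr//; lra.
have hx : 0 <= h * x by rewrite mulr_ge0.
(* With y = h x <= h, 1 - exp(-y) >= y / (1 + y) >= y / (1 + h). *)
have E : h * x <= (1 + h) * (1 - expR (- (h * x))).
  have E1 : (1 + h * x) * expR (- (h * x)) <= 1.
    rewrite mulrC -ler_pdivlMr; last by lra.
    by rewrite mul1r expRN_le_inv.
  have x1 : x <= 1 by rewrite exprn_ile1.
  have E2 : expR (- (h * x)) <= 1 by rewrite -expR0 ler_expR oppr_le0.
  have E3 : 0 <= h * (1 - x) * (1 - expR (- (h * x))).
    by rewrite !mulr_ge0// subr_ge0.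
  lra.
have : q * (h * x) <= q * ((1 + h) * (1 - expR (- (h * x)))).
  by apply: ler_wpM2l => //; exact: ltW.
have : 0 <= h * (q * (1 - t) * x + G - D) by rewrite mulr_ge0// subr_ge0.
have : 0 <= h * h * (G - q * t * x) by rewrite !mulr_ge0// subr_ge0.
set e := expR _; lra.
Qed.

Lemma onem_lambda_ge {R : realType} (k : nat) (q h : R) :
  0 < q -> q <= 1 -> 0 <= h ->
  h * ((1 - (1 - q) ^+ k.+1) / k.+1%:R) <= (1 + h) * (q * (1 - lambda k q h)).
Proof.
move=> q0 q1 h0.
have [[t]] := lambda_is_max k q h; rewrite in_itv/= => /andP[t0 t1] -> _.
exact: onem_Lambda_ge.
Qed.

(** * Measurable pieces of [Delta_bar] near the diagonal *)

Section Diagonal_mass.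
Local Open Scope classical_set_scope.

Definition triangle {R : realType} (r s : R) : set (R * R) :=
  (`[0, r] `*` `[0, s]) `&` @Delta_bar R.

Definition diagonal {R : realType} (b : R) : set (R * R) :=
  triangle b b `\` @Delta R.

Definition strip {R : realType} (h b : R) : set (R * R) :=
  triangle b b `&` [set z | z.2 <= z.1 + h].

(** These are the points with a < x <= y <= b; as a difference of two triangles, the set has a mass
    given directly by the distribution function. *)
Definition box {R : realType} (a b : R) : set (R * R) :=
  triangle b b `\` triangle a b.

Lemma triangleE {R : realType} (r s : R) (z : R * R) :
  triangle r s z <-> [/\ 0 <= z.1, z.1 <= z.2, z.1 <= r & z.2 <= s].
Proof.
split.
  by move=> [[/=]]; rewrite !in_itv/= => /andP[? ?] /andP[? ?] [].
move=> [x0 xy xr ys]; have y0 := le_trans x0 xy.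
by split; [split; rewrite /= in_itv/=; apply/andP | split].
Qed.

Lemma measurable_ler_set {R : realType} (f g : R * R -> R) :
  measurable_fun setT f -> measurable_fun setT g ->
  measurable [set z | f z <= g z].
Proof.
move=> mf mg.
have := measurable_realfun.measurable_fun_ler mf mg.
by move=> /(_ measurableT [set true] I); rewrite setTI.
Qed.

Lemma measurable_Delta_bar {R : realType} : measurable (@Delta_bar R).
Proof.
have -> : @Delta_bar R = [set z | 0 <= z.1] `&` [set z | 0 <= z.2]
                         `&` [set z | z.1 <= z.2].
  by apply/seteqP; split=> z /=; [case | case=> [[]]].
apply: measurableI; first apply: measurableI; apply: measurable_ler_set.
- exact: measurable_cst.
- exact: measurable_fst.
- exact: measurable_cst.
- exact: measurable_snd.
- exact: measurable_fst.
- exact: measurable_snd.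
Qed.

Lemma measurable_triangle {R : realType} (r s : R) : measurable (triangle r s).
Proof.
by apply: measurableI; [apply: measurableX | exact: measurable_Delta_bar].
Qed.

Lemma measurable_diagonal {R : realType} (b : R) : measurable (diagonal b).
Proof.
by apply: measurableD; [exact: measurable_triangle | exact: measurable_Delta].
Qed.

Lemma measurable_below {R : realType} (h : R) :
  measurable [set z : R * R | z.2 <= z.1 + h].
Proof.
apply: measurable_ler_set; first exact: measurable_snd.
apply: measurable_realfun.measurable_funD; first exact: measurable_fst.
exact: measurable_cst.
Qed.

Lemma measurable_strip {R : realType} (h b : R) : measurable (strip h b).
Proof.
by apply: measurableI; [exact: measurable_triangle | exact: measurable_below].
Qed.

Lemma measurable_box {R : realType} (a b : R) : measurable (box a b).
Proof. by apply: measurableD; exact: measurable_triangle. Qed.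

Lemma fine_prob_le {d} {T : measurableType d} {R : realType}
    (P : probability T R) (A B : set T) :
  measurable A -> measurable B -> A `<=` B -> fine (P A) <= fine (P B).
Proof.
move=> mA mB AB; apply: fine_le; [exact: fin_num_measure..|].
by apply: le_measure => //; rewrite inE.
Qed.

Lemma fine_probU {d} {T : measurableType d} {R : realType}
    (P : probability T R) (A B : set T) :
  measurable A -> measurable B -> A `&` B = set0 ->
  fine (P (A `|` B)) = fine (P A) + fine (P B).
Proof.
move=> mA mB AB; rewrite measureU// fineD//; exact: fin_num_measure.
Qed.

Lemma fine_probU_le {d} {T : measurableType d} {R : realType}
    (P : probability T R) (A B : set T) :
  measurable A -> measurable B ->
  fine (P (A `|` B)) <= fine (P A) + fine (P B).
Proof.
move=> mA mB; rewrite -fineD; [|exact: fin_num_measure..].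
apply: fine_le; [| |exact: measureU2].
  by apply: fin_num_measure; exact: measurableU.
by rewrite fin_numD !fin_num_measure.
Qed.

(** * Masses of squares, strips and diagonal segments *)

(** The two triangles fall under different branches of [beta_hat], and the common term
    [lambda k 1 b] cancels in the difference. *)
Lemma box_mass {R : realType} (k : nat) (P : probability (R * R)%type R)
    (a b : R) : is_xi_Ver k P -> 0 <= a -> a < b ->
  fine (P (box a b)) = expR (- a) * (1 - lambda k (expR (- a)) (b - a)).
Proof.
move=> [_ PT] a0 ab; have b0 := le_trans a0 (ltW ab).
have sub : triangle a b `<=` triangle b b.
  move=> z /triangleE[? ? za ?]; apply/triangleE; split=> //.
  exact: le_trans za (ltW ab).
have mT r s := @measurable_triangle R r s.
have := fine_probU P _ _ (mT a b) (measurable_box a b) (setDIK _ _).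
rewrite /box setDUK// !PT//= /beta_hat ltxx ab => E; lra.
Qed.


(** Induction on the number of squares: the next square is disjoint from the strip so far and stays
    in the longer strip because its side is h. *)
Lemma strip_mass_ge {R : realType} (k : nat) (P : probability (R * R)%type R)
    (h : R) (n : nat) : is_xi_Ver k P -> 0 < h ->
  diag_cdf k (n%:R * h) <= (1 + h) * fine (P (strip h (n%:R * h))).
Proof.
move=> hP h0; elim: n => [|n IH].
  rewrite mul0r diag_cdf0 mulr_ge0//; [lra | exact: fine_ge0].
have a0 : 0 <= n%:R * h by rewrite mulr_ge0// ltW.
have bE : n.+1%:R * h = n%:R * h + h by rewrite -natr1 mulrDl mul1r.
move: IH bE a0; set a := n%:R * h; set b := n.+1%:R * h => IH bE a0.
have ab : a < b by lra.
have bah : b - a = h by lra.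
have /andP[_] := @diag_cdf_mvt _ k a b a0 ab.
have := box_mass k P _ _ hP a0 ab; rewrite bah => boxE ub.
have q1 : expR (- a) <= 1 by rewrite -expR0 ler_expR oppr_le0.
have := @onem_lambda_ge _ k (expR (- a)) h (expR_gt0 _) q1 (ltW h0).
rewrite -boxE -/(diag_density k a) => lb.
have st : fine (P (strip h a)) + fine (P (box a b)) <= fine (P (strip h b)).
  rewrite -fine_probU; [|exact: measurable_strip|exact: measurable_box|].
    apply: fine_prob_le; [|exact: measurable_strip|].
      by apply: measurableU; [exact: measurable_strip|exact: measurable_box].
    move=> z [[/triangleE[z0 zz za zb] /= zh]|[zT nT]].
      by split=> //; apply/triangleE; split=> //; lra.
    split=> //=; move: zT => /triangleE[z0 zz zb1 zb2].
    have [za|za] := leP z.1 a; last lra.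
    by exfalso; apply: nT; apply/triangleE.
  rewrite -subset0 => z [[/triangleE[z0 zz za zb] _] [_]]; apply.
  by apply/triangleE; split=> //; lra.
have : (1 + h) * (fine (P (strip h a)) + fine (P (box a b)))
    <= (1 + h) * fine (P (strip h b)) by rewrite ler_wpM2l//; lra.
lra.
Qed.

(** The squares give an upper Riemann sum of the nonincreasing density g. Its errors h (g(a) - g(b))
    telescope, and 1 serves as an upper bound for g(0). *)
Lemma diagonal_mass_le {R : realType} (k : nat) (P : probability (R * R)%type R)
    (h : R) (n : nat) : is_xi_Ver k P -> 0 < h ->
  fine (P (diagonal (n%:R * h)))
  <= diag_cdf k (n%:R * h) + h * (1 - diag_density k (n%:R * h)).
Proof.
move=> hP h0; elim: n => [|n IH].
  rewrite mul0r diag_cdf0 add0r (@le_trans _ _ 0)//; last first.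
    by rewrite mulr_ge0 ?subr_ge0 ?diag_density_le1// ltW.
  (* The origin has no mass: [onem_lambda_le] with h = 0 gives 1 - lambda <= 0. *)
  have sub : diagonal (0 : R) `<=` triangle 0 0 by exact: subDsetl.
  apply: le_trans (fine_prob_le P _ _ _ _ sub) _.
  - exact: measurable_diagonal.
  - exact: measurable_triangle.
  rewrite (proj2 hP)//= /beta_hat ltxx oppr0 expR0.
  by have := @onem_lambda_le R k 1 0 ltr01; rewrite mul0r mul1r; lra.
have a0 : 0 <= n%:R * h by rewrite mulr_ge0// ltW.
have bE : n.+1%:R * h = n%:R * h + h by rewrite -natr1 mulrDl mul1r.
move: IH bE a0; set a := n%:R * h; set b := n.+1%:R * h => IH bE a0.
have ab : a < b by lra.
have bah : b - a = h by lra.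
have /andP[+ _] := @diag_cdf_mvt _ k a b a0 ab.
have := box_mass k P _ _ hP a0 ab; rewrite bah => boxE lb.
have := @onem_lambda_le _ k (expR (- a)) h (expR_gt0 _).
rewrite -boxE -/(diag_density k a) => ub.
have dg : fine (P (diagonal b)) <= fine (P (diagonal a)) + fine (P (box a b)).
  have [mD mB] := (@measurable_diagonal R a, @measurable_box R a b).
  apply: le_trans (fine_probU_le P _ _ mD mB).
  apply: fine_prob_le; [exact: measurable_diagonal|exact: measurableU|].
  move=> z [zT nD]; have /triangleE[z0 zz za zb] := zT.
  have zE : z.2 <= z.1.
    rewrite leNgt; apply/negP => zlt.
    by apply: nD; split=> //; apply: le_trans zz.
  have [za'|za'] := leP z.1 a; [left|right]; split=> //.
    by apply/triangleE; split=> //; lra.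
  by move/triangleE => [_ _]; lra.
lra.
Qed.

(** * Passage to the limit *)

Lemma full_diagonal_mass {R : realType} (k : nat)
    (P : probability (R * R)%type R) : is_xi_Ver k P ->
  fine (P (@Delta_bar R `\` @Delta R))
  = (k.+1%:R)^-1 * \sum_(1 <= j < k.+2) (j%:R)^-1.
Proof.
move=> hP; set c := RHS; set D := _ `\` _.
have mD : measurable D.
  by apply: measurableD; [exact: measurable_Delta_bar|exact: measurable_Delta].
have PDE : P D = (fine (P D))%:E by rewrite fineK// fin_num_measure.
have DE z : D z <-> 0 <= z.1 /\ z.1 = z.2.
  split=> [[[z0 z0' zz] nD]|[z0 zz]].
    split=> //; apply/eqP; rewrite eq_le zz leNgt; apply/negP => zlt.
    by apply: nD.
  by rewrite /D /Delta_bar /Delta /= -zz; split=> [|[]]; rewrite ?ltxx.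
have h0 n : 0 < harmonic n :> R by rewrite /harmonic /= invr_gt0.
(* Taking (n+1)^2 squares of side 1/(n+1) reaches n+1, so the mesh shrinks while the range grows. *)
have Nh n : (n.+1 * n.+1)%:R * harmonic n = n.+1%:R :> R.
  by rewrite natrM mulfK// pnatr_eq0.
have harm0 := @cvg_harmonic R.
apply/eqP; rewrite eq_le; apply/andP; split.
  (* Upper bound: continuity from below along growing diagonal segments. *)
  have UE : \bigcup_n diagonal (n.+1%:R : R) = D.
    apply/seteqP; split=> z.
      by move=> [n _ [[_ zD] nD]].
    move=> zD; have /DE[z0 zz] := zD; exists (Num.bound z.1) => //.
    have lb : z.1 <= (Num.bound z.1).+1%:R.
      by rewrite ltW// (lt_le_trans (archi_boundP z0))// ler_nat.
    by split; [apply/triangleE; rewrite -zz|exact: zD.2].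
  have : (P \o (fun n => diagonal (n.+1%:R : R))) x @[x --> \oo] --> P D.
    rewrite -UE; apply: nondecreasing_cvg_mu.
    - by move=> n; exact: measurable_diagonal.
    - by rewrite UE.
    - move=> m n mn; apply/subsetPset => z [/triangleE[z0 zz z1 z2] nD].
      split=> //; apply/triangleE.
      split=> //; [apply: le_trans z1 _|apply: le_trans z2 _];
        by rewrite ler_nat.
  rewrite PDE => /fine_cvg PD.
  have cE : c + harmonic n @[n --> \oo] --> c + 0.
    by apply: cvgD => //; exact: cvg_cst.
  rewrite -[leRHS]addr0; apply: (ler_cvg_to PD cE); apply: nearW => n /=.
  have := @diagonal_mass_le R k P (harmonic n) (n.+1 * n.+1) hP (h0 n).
  rewrite Nh => /le_trans; apply; apply: lerD; first exact: diag_cdf_le.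
  apply: ler_piMr; first exact: ltW.
  by rewrite lerBlDr lerDl diag_density_ge0.
(* Lower bound: continuity from above along unbounded strips of shrinking width, each containing the
   truncated strip already estimated. *)
have IE : \bigcap_n (@Delta_bar R `&` [set z | z.2 <= z.1 + harmonic n]) = D.
  apply/seteqP; split=> z.
    move=> zI; have [zD _] := zI 0%N I; have [z0 _ zz] := zD.
    apply/DE; split=> //; apply/eqP; rewrite eq_le zz/=.
    have zE : z.1 + harmonic n @[n --> \oo] --> z.1 + 0.
      by apply: cvgD => //; exact: cvg_cst.
    rewrite -[leRHS]addr0; apply: (ler_cvg_to (cvg_cst z.2) zE).
    by apply: nearW => n; have [_] := zI n I.
  move=> zD n _; split; first exact: zD.1.
  by have /DE[_ zz] := zD; rewrite /= -zz lerDl ltW.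
have mV n : measurable (@Delta_bar R `&` [set z | z.2 <= z.1 + harmonic n]).
  by apply: measurableI; [exact: measurable_Delta_bar|exact: measurable_below].
have : (P \o (fun n => @Delta_bar R `&` [set z | z.2 <= z.1 + harmonic n])) x
    @[x --> \oo] --> P D.
  rewrite -IE; apply: nonincreasing_cvg_mu => //.
  - by apply: (le_lt_trans (probability_le1 P (mV 0%N))); rewrite ltry.
  - by rewrite IE.
  - move=> m n mn; apply/subsetPset => z [zD /= zn]; split=> //=.
    apply: le_trans zn _; rewrite lerD2l lef_pV2 ?posrE// ler_nat.
    by rewrite ltnS.
rewrite PDE => /fine_cvg PD.
(* One [harmonic n] pays for the tail of [diag_cdf] beyond n+1, the other for the factor 1 + h,
   since the strip has mass at most 1. *)
have cE : c - (harmonic n + harmonic n) @[n --> \oo] --> c - (0 + 0).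
  by apply: cvgB; [exact: cvg_cst|exact: cvgD].
rewrite -[leLHS]subr0 -[X in _ - X](addr0 0).
apply: (ler_cvg_to cE PD); apply: nearW => n.
have := @strip_mass_ge R k P (harmonic n) (n.+1 * n.+1) hP (h0 n).
rewrite Nh => st.
have := @diag_cdf_ge R k n.+1%:R (ler0n _ _); rewrite -/c.
have inv_le : (1 + n.+1%:R)^-1 <= harmonic n :> R.
  by rewrite nat1r lef_pV2 ?posrE// ler_nat.
have sV : fine (P (strip (harmonic n) n.+1%:R)) <=
    fine (P (@Delta_bar R `&` [set z | z.2 <= z.1 + harmonic n])).
  apply: fine_prob_le => //; first exact: measurable_strip.
  by move=> z [[]].
have V1 : fine (P (strip (harmonic n) n.+1%:R)) <= 1.
  rewrite -[leRHS]/(fine 1%:E); apply: fine_le => //.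
    by apply: fin_num_measure; exact: measurable_strip.
  by apply: probability_le1; exact: measurable_strip.
move: (h0 n) st inv_le sV V1.
set s := fine (P (strip _ _)); set v := fine _; set h := harmonic n.
move=> h_gt0 st inv_le sV V1 cl.
have : 0 <= h * (1 - s) by rewrite mulr_ge0 ?subr_ge0// ltW.
by move=> hs; rewrite -[leRHS]/v; lra.
Qed.

End Diagonal_mass.

Theorem mainTheorem4 (R : realType) (k : nat) (hk : (1 <= k)%N)
    (xi_Ver : probability (R * R)%type R) (hxi : is_xi_Ver k xi_Ver) :
  xi_hat xi_Ver (@Delta R)
  = (1 - (k.+1%:R)^-1 * \sum_(1 <= j < k.+2) (j%:R)^-1)%:E.
Proof.
(* [Delta] and the diagonal partition [Delta_bar], which has mass 1. *)
rewrite -(full_diagonal_mass _ _ hxi) /xi_hat /mrestr setIid.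
have mD := measurableD (@measurable_Delta_bar R) (@measurable_Delta R).
have sub : (@Delta R `<=` @Delta_bar R)%classic.
  by move=> z [z0 z1 /ltW zz].
rewrite -(fineK (fin_num_measure xi_Ver _ (@measurable_Delta R))).
have := fine_probU xi_Ver _ _ (@measurable_Delta R) mD (setDIK _ _).
rewrite setDUK// hxi.1 /= => ->; by rewrite addrK.
Qed.
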